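(* Let $\Phi$ and $\Phi_1$ be admissible functions and let $(X,d_X)$ and $(Y,d_Y)$ be uniformly perfect metric spaces, each with more than one point. Let $F\subseteq X$ be non-empty and totally bounded, let $f\colon F\to Y$ be a Hölder map with exponent $\alpha\in(0,1]$, assume $\dim_{\mathrm A}f(F)<\infty$, and let $\gamma\in[1,1/\alpha]$. Assume that $$\Phi_1(\delta)\le\left(\Phi(\delta^{1/(\alpha\gamma)})\right)^\alpha$$ for all sufficiently small $\delta>0$, and suppose $\overline{\dim}^\Phi F<\alpha\dim_{\mathrm A}f(F)$. Then $$\overline{\dim}^{\Phi_1}f(F)\le\frac{\overline{\dim}^\Phi F+\alpha(\gamma-1)\dim_{\mathrm A}f(F)}{\alpha\gamma}.$$ The same holds with $\overline{\dim}$ replaced by $\underline{\dim}$ throughout.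
   Context: For a subset $U$ of a metric space, $|U|$ denotes its diameter, and $B(x,r)$ is the open ball. Convention: $\inf\varnothing=\infty$. A metric space $X$ is uniformly perfect if there is $c\in(0,1)$ such that $B(x,R)\setminus B(x,cR)\neq\varnothing$ for all $x\in X$ and $0<R<|X|$. $N_\delta(F)$ is the smallest number of open balls of radius $\delta/2$ with centres in $F$ needed to cover $F$; $F$ is totally bounded if $N_\delta(F)<\infty$ for all $\delta>0$. A map $f$ is Hölder with exponent $\alpha\in(0,1]$ if there is $C\in[0,\infty)$ with $d_Y(f(x_1),f(x_2))\le C\,d_X(x_1,x_2)^\alpha$ for all $x_1,x_2$ in its domain. A function $\Phi\colon(0,\Delta)\to\mathbb{R}$ (for some $\Delta>0$) is admissible if it is monotonic, $0<\Phi(\delta)\le\delta$ for all $\delta\in(0,\Delta)$, and $\Phi(\delta)/\delta\to0$ as $\delta\to0^+$. For a non-empty totally bounded subset $F$ of a metric space $X$ and admissible $\Phi$, the upper $\Phi$-intermediate dimension $\overline{\dim}^\Phi F$ is the infimum of all $s\ge0$ such that for all $\epsilon>0$ there exists $\delta_0\in(0,1]$ (with $(0,\delta_0)$ contained in the domain of $\Phi$) such that for all $\delta\in(0,\delta_0)$ there is a finite or countable cover $\{U_1,U_2,\dots\}$ of $F$ by subsets of the ambient space with $\Phi(\delta)\le|U_i|\le\delta$ for all $i$ and $\sum_i|U_i|^s\le\epsilon$. The lower $\Phi$-intermediate dimension $\underline{\dim}^\Phi F$ is the infimum of all $s\ge0$ such that for all $\epsilon>0$ and $\delta_0\in(0,1]$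 there exist $\delta\in(0,\delta_0)$ (in the domain of $\Phi$) and such a cover of $F$ with $\Phi(\delta)\le|U_i|\le\delta$ for all $i$ and $\sum_i|U_i|^s\le\epsilon$. (For $f(F)$ the ambient space is $Y$.) The Assouad dimension $\dim_{\mathrm A}E$ is the infimum of all $a$ for which there exists $C>0$ such that $N_r(B(x,R)\cap E)\le C(R/r)^a$ for all $x\in E$ and $0<r<R$. *)

(* Defs.v *)
From HB Require Import structures.
From mathcomp Require Import all_boot all_order all_algebra.
From mathcomp Require Import all_classical all_reals all_analysis.

Set Implicit Arguments.
Unset Strict Implicit.
Unset Printing Implicit Defensive.

Import Order.TTheory GRing.Theory Num.Theory.
Import numFieldNormedType.Exports.

Local Open Scope classical_set_scope.
Local Open Scope ring_scope.

Section MetricNotions.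
Context {R : realType} {T : metricType R}.
Implicit Types (U F E : set T) (c r d a s : R).

(* The maximum with 0 only matters for the empty set, whose diameter is 0
   (the supremum of the empty set is -oo in \bar R). *)
Definition diam U : \bar R :=
  maxe 0%E (ereal_sup [set (mdist p.1 p.2)%:E | p in U `*` U]).

Definition uniformly_perfect : Prop :=
  exists2 c : R, 0 < c < 1 &
    forall (x : T) (r : R), 0 < r -> (r%:E < diam [set: T])%E ->
      (ball x r `\` ball x (c * r)) !=set0.

Definition covering_number d F : \bar R :=
  ereal_inf [set n%:R%:E | n in [set n | exists x : 'I_n -> T,
    (forall i, F (x i)) /\ F `<=` \bigcup_i ball (x i) (d / 2)]].

Definition totally_bounded F : Prop :=
  forall d : R, 0 < d -> (covering_number d F < +oo)%E.

Definition assouad_dim E : \bar R :=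
  ereal_inf [set a%:E | a in [set a | exists2 C : R, 0 < C &
    forall (x : T) (r r' : R), E x -> 0 < r -> r < r' ->
      (covering_number r (ball x r' `&` E) <= (C * (r' / r) `^ a)%:E)%E]].

(* The index set I is an arbitrary subset of nat, so that the covers
   (U i)_(i in I) are the finite or countable ones. *)
Definition has_cover F (lo hi s eps : R) : Prop :=
  exists (I : set nat) (U : nat -> set T),
    [/\ F `<=` \bigcup_(i in I) U i,
        forall i, I i -> (lo%:E <= diam (U i) <= hi%:E)%E
      & (\esum_(i in I) (diam (U i) `^ s) <= eps%:E)%E].

(* Phi is a total function, but only its values on ]0, Delta[ are used. *)
Definition upper_Phi_dim (Delta : R) (Phi : R -> R) F : \bar R :=
  ereal_inf [set s%:E | s in [set s | 0 <= s /\
    forall eps : R, 0 < eps ->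
      exists d0 : R, [/\ 0 < d0 <= 1, d0 <= Delta &
        forall d : R, 0 < d < d0 -> has_cover F (Phi d) d s eps]]].

Definition lower_Phi_dim (Delta : R) (Phi : R -> R) F : \bar R :=
  ereal_inf [set s%:E | s in [set s | 0 <= s /\
    forall eps d0 : R, 0 < eps -> 0 < d0 <= 1 ->
      exists d : R, [/\ 0 < d < d0, d < Delta &
        has_cover F (Phi d) d s eps]]].

End MetricNotions.

Arguments uniformly_perfect {R} T.

Definition admissible {R : realType} (Delta : R) (Phi : R -> R) : Prop :=
  [/\ 0 < Delta,
      {in `]0, Delta[ &, {homo Phi : x y / x <= y}} \/
      {in `]0, Delta[ &, {homo Phi : x y / x <= y >-> y <= x}},
      forall d : R, 0 < d < Delta -> 0 < Phi d <= d
    & Phi d / d @[d --> 0^'+] --> 0].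

Definition holder_on {R : realType} {X Y : metricType R}
    (F : set X) (alpha : R) (f : X -> Y) : Prop :=
  exists2 C : R, 0 <= C & forall x1 x2, F x1 -> F x2 ->
    mdist (f x1) (f x2) <= C * mdist x1 x2 `^ alpha.

(* Main.v *)
(* Take a cover of F by sets U of diameter u, with u between Phi(d') and
   d' = d ^ (1 / (alpha gamma)), and let s be its exponent and a > dim_A f(F).
   By the Hoelder bound each f(U) lies in a ball of radius K u ^ alpha.  If that
   radius is at most d / 2, keep this one ball: uniform perfectness of Y gives
   it, for K large, diameter at least u ^ alpha >= Phi(d') ^ alpha >= Phi1(d).
   Otherwise cover f(U) by a constant times (u ^ alpha / d) ^ a balls of radius
   d / 2, whose diameters exceed Phi1(d) because Phi1(d) / d -> 0.  With exponent
   t = (s + alpha (gamma - 1) a) / (alpha gamma), both choices cost at most a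
   constant times u ^ s as soon as s <= alpha a. *)
Require Import Defs.
From mathcomp Require Import all_boot all_order all_algebra.
From mathcomp Require Import all_classical all_reals all_analysis.
From mathcomp Require Import ring lra.
Import Order.TTheory GRing.Theory Num.Theory.
Import numFieldNormedType.Exports.
Local Open Scope classical_set_scope.
Local Open Scope ring_scope.

(** * Diameters of balls and covering numbers *)

Section Diameter.
Context {R : realType} {T : metricType R}.
Implicit Types (U E : set T) (c r d : R).

Lemma mdist_le_diam {U x y} : U x -> U y -> ((mdist x y)%:E <= diam U)%E.
Proof.
move=> Ux Uy; rewrite /diam le_max; apply/orP; right.
by apply: ereal_sup_ubound; exists (x, y).
Qed.

Lemma diam_ball_le (x : T) r : 0 <= r -> (diam (ball x r) <= (2 * r)%:E)%E.
Proof.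
move=> r0; rewrite /diam ge_max lee_fin mulr_ge0//=.
apply: ge_ereal_sup => _ [[y z] [/= xy xz] <-]; rewrite lee_fin.
move: xy xz; rewrite !ballEmdist/= => xy xz.
have := @metric_triangle _ T y x z; rewrite [mdist y x]metric_sym; lra.
Qed.

(** The point that uniform perfectness provides lies in the ball at distance at least [c * r] from
    the centre. *)
Lemma diam_ball_ge (x : T) c r : 0 < r ->
  ball x r `\` ball x (c * r) !=set0 -> ((c * r)%:E <= diam (ball x r))%E.
Proof.
move=> r0 [y [xy]]; rewrite [ball x (c * r)]ballEmdist/= => /negP.
rewrite -leNgt => cr; apply: le_trans (mdist_le_diam (ballxx x r0) xy).
by rewrite lee_fin.
Qed.

Lemma diam_setT_gt0 : (exists x y : T, x <> y) -> (0 < diam [set: T])%E.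
Proof.
move=> [x [y xy]]; apply: lt_le_trans (@mdist_le_diam setT x y I I).
by rewrite lte_fin mdist_gt0; apply/eqP.
Qed.

(* The factor 2 spares us showing that the infimum is attained. *)
Lemma covering_number_le E d (b : R) : 0 < b ->
  (covering_number d E <= b%:E)%E ->
  exists n (x : 'I_n -> T),
    n%:R <= 2 * b /\ E `<=` \bigcup_i ball (x i) (d / 2).
Proof.
move=> b0 Eb; have : (covering_number d E < (2 * b)%:E)%E.
  by apply: le_lt_trans Eb _; rewrite lte_fin; lra.
move=> /ereal_inf_lt[_ [n [x [_ Ex]] <-]]; rewrite lte_fin => nb.
by exists n, x; split=> //; exact: ltW.
Qed.

End Diameter.

(** * Gluing covers of the images of the pieces *)

Lemma le_esumZ {R : realType} {T : choiceType} (I : set T) (M : R)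
    (a : T -> \bar R) : 0 <= M -> (forall i, 0 <= a i)%E ->
  (\esum_(i in I) (M%:E * a i) <= M%:E * \esum_(i in I) a i)%E.
Proof.
move=> M0 a0; apply: ge_ereal_sup => _ [X [finX XI] <-].
rewrite -ge0_mule_fsumr// lee_wpmul2l ?lee_fin//.
by apply: esum_ge; exists X.
Qed.

(** The finite families are merged into one countable family by coding pairs (piece, member) as
    naturals; the double sum of costs is then bounded piece by piece. *)
Lemma has_cover_glue {R : realType} {X Y : metricType R} (F : set X)
    (f : X -> Y) (lo hi s eps lo' hi' t M : R) : 0 <= M ->
  (forall U, (lo%:E <= diam U <= hi%:E)%E -> exists n (V : nat -> set Y),
    [/\ f @` (U `&` F) `<=` \bigcup_(j in `I_n) V j,
        forall j, (j < n)%N -> (lo'%:E <= diam (V j) <= hi'%:E)%E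
      & (\esum_(j in `I_n) (diam (V j) `^ t) <= M%:E * diam U `^ s)%E]) ->
  has_cover F lo hi s eps -> has_cover (f @` F) lo' hi' t (M * eps).
Proof.
move=> M0 VP [I [U [FU Ubnd Usum]]].
have /choice[nV nVP] : forall i, exists nV : nat * (nat -> set Y), I i ->
    [/\ f @` (U i `&` F) `<=` \bigcup_(j in `I_nV.1) nV.2 j,
        forall j, (j < nV.1)%N -> (lo'%:E <= diam (nV.2 j) <= hi'%:E)%E
      & (\esum_(j in `I_nV.1) (diam (nV.2 j) `^ t)
           <= M%:E * diam (U i) `^ s)%E].
  move=> i; have [Ii|nIi] := pselect (I i); last by exists (0%N, fun=> set0).
  by have [n [V ?]] := VP _ (Ubnd _ Ii); exists (n, V).
pose P := I `*`` (fun i => `I_(nV i).1).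
pose W (p : nat * nat) := (nV p.1).2 p.2.
(* The default pair is harmless: the index set consists of codes only. *)
pose V k := W (odflt (0, 0)%N (unpickle k)).
have VE p : V (pickle p) = W p by rewrite /V pickleK.
exists (pickle @` P), V; split.
- move=> _ [x Fx <-]; have [i Ii Uix] := FU _ Fx.
  have [+ _ _] := nVP _ Ii; move=> /(_ (f x)) []; first by exists x.
  by move=> j jn Vj; exists (pickle (i, j)); [exists (i, j)|rewrite VE].
- by move=> _ [[i j] [Ii jn] <-]; rewrite VE; have [_ + _] := nVP _ Ii; exact.
- rewrite esum_image; last by move=> p q _ _; exact: (pcan_inj pickleK).
  under eq_esum do rewrite VE.
  rewrite -(@esum_esum _ _ _ I (fun i => `I_(nV i).1)
    (fun i j => (diam (W (i, j)) `^ t)%E)); last first.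
    by move=> *; exact: poweR_ge0.
  apply: (@le_trans _ _ (\esum_(i in I) (M%:E * diam (U i) `^ s))%E).
    by apply: le_esum => i Ii; have [] := nVP _ Ii.
  apply: (le_trans (le_esumZ I M _ M0 _)); first by move=> i; exact: poweR_ge0.
  by rewrite EFinM lee_wpmul2l ?lee_fin.
Qed.

(** * From exponents to their infima *)

(** Take [s] and [a] close to the infima of [S] and [A]. The strict inequality between these leaves
    room to keep [s] below [alpha] times the infimum of [A], so that [s <= alpha * a]. *)
Lemma ereal_inf_transfer {R : realType} (S A S1 : set R) (alpha m k : R) :
  0 < alpha -> 0 < k -> 0 <= m -> (forall s, S s -> 0 <= s) ->
  (ereal_inf (EFin @` A) < +oo)%E ->
  (ereal_inf (EFin @` S) < alpha%:E * ereal_inf (EFin @` A))%E ->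
  (forall s a, S s -> A a -> s <= alpha * a -> S1 ((s + m * a) / k)) ->
  (ereal_inf (EFin @` S1) <=
     (ereal_inf (EFin @` S) + m%:E * ereal_inf (EFin @` A)) / k%:E)%E.
Proof.
move=> alpha0 k0 m0 S0.
have : (0 <= ereal_inf (EFin @` S))%E.
  by apply: le_ereal_inf_tmp => _ [s /S0 s0 <-]; rewrite lee_fin.
have := @ereal_inf_lbound _ (EFin @` A).
have := @ereal_inf_lt _ (EFin @` A).
case: (ereal_inf (EFin @` A)) => [D| |]//; last first.
  move=> _ _ inf0 _; rewrite gt0_muleNy ?lte_fin// => /(le_lt_trans inf0).
  by rewrite ltNge leNye.
have := @ereal_inf_lt _ (EFin @` S).
case: (ereal_inf (EFin @` S)) => [s0| |]// infS infA Dle _ _.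
rewrite -EFinM lte_fin => s0D S1P.
rewrite inver gt_eqF// -[(_ * D%:E)%E]EFinM -(EFinD s0) -EFinM.
apply/lee_addgt0Pr => e e0.
(* Exceeding both infima by at most [h] raises (s + m a) / k by at most h (1 + m) / k = e. *)
pose h := e * k / (1 + m).
have m1 : 0 < 1 + m by lra.
have h0 : 0 < h by rewrite /h divr_gt0 ?mulr_gt0.
have [|_ [s Ss <-]] := infS (Num.min (s0 + h) (alpha * D))%:E.
  by rewrite lte_fin lt_min s0D andbT ltrDl.
rewrite lte_fin lt_min => /andP[sh sD].
have [|_ [a Aa <-]] := infA (D + h)%:E; first by rewrite lte_fin ltrDl.
rewrite lte_fin => aD.
have Da : D <= a by rewrite -lee_fin; apply: Dle; exists a.
apply: ge_ereal_inf; exists ((s + m * a) / k)%:E.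
  exists ((s + m * a) / k) => //; apply: S1P => //.
  by apply: (le_trans (ltW sD)); rewrite ler_pM2l.
rewrite -EFinD lee_fin -(ler_pM2r k0) [leRHS]mulrDl !divfK ?gt_eqF//.
have -> : e * k = h + m * h by rewrite /h; field; rewrite gt_eqF.
have := ler_wpM2l m0 (ltW aD); lra.
Qed.

(** * Covering the image of a single set *)

Lemma esum_le_const {R : realType} (n : nat) (a : nat -> \bar R) (b : R) :
  (forall j, 0 <= a j)%E -> (forall j, (j < n)%N -> (a j <= b%:E)%E) ->
  (\esum_(j in `I_n) a j <= (n%:R * b)%:E)%E.
Proof.
move=> a0 ab; rewrite esum_fset// -fsbig_ord.
apply: (@le_trans _ _ (\sum_(j < n) b%:E)%E).
  by apply: lee_sum => j _; exact: ab.
by rewrite sumEFin big_const_ord iter_addr_0 mulr_natl.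
Qed.

Section HolderImage.
Context {R : realType} (alpha gamma s a : R).
Hypotheses (alpha0 : 0 < alpha) (gamma1 : 1 <= gamma).
Hypotheses (s0 : 0 <= s) (sa : s <= alpha * a).

Let t := (s + alpha * (gamma - 1) * a) / (alpha * gamma).

Let gamma0 : 0 < gamma. Proof. exact: lt_le_trans gamma1. Qed.

Let ag0 : 0 < alpha * gamma. Proof. exact: mulr_gt0. Qed.

Let a0 : 0 <= a.
Proof. by rewrite -(pmulr_rge0 _ alpha0); exact: le_trans sa. Qed.

Lemma image_exponent_ge0 : 0 <= t.
Proof.
apply: divr_ge0; last exact: ltW.
by rewrite addr_ge0// !mulr_ge0// ?subr_ge0// ltW.
Qed.

(** As u <= 1, it suffices that alpha t >= s; multiplied by [gamma], this is (gamma - 1)(alpha a -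
    s) >= 0. *)
Lemma small_piece_cost (u : R) : 0 < u <= 1 -> (u `^ alpha) `^ t <= u `^ s.
Proof.
move=> u01; rewrite -powRrM ger_powR// /t.
rewrite -(ler_pM2r gamma0).
have -> : alpha * ((s + alpha * (gamma - 1) * a) / (alpha * gamma)) * gamma
    = s + (gamma - 1) * (alpha * a).
  by field; rewrite !gt_eqF.
have : (gamma - 1) * s <= (gamma - 1) * (alpha * a).
  by rewrite ler_wpM2l// subr_ge0.
lra.
Qed.

(** Here t - a = -(alpha a - s) / (alpha gamma), so the claim reduces to the bound on [u] raised to
    the power alpha a - s >= 0. The exponent [t] is the one giving equality at the largest allowed
    [u]. *)
Lemma large_piece_cost (u d : R) : 0 < u -> 0 < d ->
  u <= d `^ (1 / (alpha * gamma)) ->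
  (u `^ alpha / d) `^ a * d `^ t <= u `^ s.
Proof.
move=> u0 d0 ud.
have -> : u `^ s = u `^ (alpha * a) / u `^ (alpha * a - s).
  by rewrite -powRB ?(gt_eqF u0) ?implybT// subKr.
have -> : (u `^ alpha / d) `^ a * d `^ t
    = u `^ (alpha * a) / d `^ ((alpha * a - s) / (alpha * gamma)).
  rewrite powRM ?powR_ge0 ?invr_ge0 ?(ltW d0)// -powRrM -mulrA.
  rewrite -powRN -powR_inv1 ?(ltW d0)// -powRrM -powRD ?(gt_eqF d0) ?implybT//.
  by congr (_ * _ `^ _); rewrite /t; field; rewrite !gt_eqF.
rewrite ler_pM2l ?powR_gt0// lef_pV2 ?posrE ?powR_gt0//.
have -> : (alpha * a - s) / (alpha * gamma)
    = 1 / (alpha * gamma) * (alpha * a - s) by rewrite mul1r mulrC.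
rewrite powRrM; apply: ge0_ler_powR; rewrite ?nnegrE ?powR_ge0 ?(ltW u0)//.
by rewrite subr_ge0.
Qed.

Context {X Y : metricType R} (F : set X) (f : X -> Y) (C c CA : R).
Hypotheses (C0 : 0 <= C) (c0 : 0 < c) (CA0 : 0 < CA).
Hypothesis f_holder : forall x y, F x -> F y ->
  mdist (f x) (f y) <= C * mdist x y `^ alpha.
Hypothesis fF_assouad : forall (y : Y) (r r' : R),
  (f @` F) y -> 0 < r -> r < r' ->
  (covering_number r (ball y r' `&` (f @` F)) <= (CA * (r' / r) `^ a)%:E)%E.

(** The term [C] absorbs the Hölder bound. The term [c^-1] makes it strict, as open balls require,
    and gives c K >= 1, so that a ball of radius K u^alpha has diameter at least u^alpha. *)
Let K := C + c^-1.

Let K0 : 0 < K. Proof. by rewrite ltr_wpDl// invr_gt0. Qed.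

Let cK : 1 <= c * K.
Proof. by rewrite mulrDr mulfV ?gt_eqF// lerDr mulr_ge0// ltW. Qed.

Lemma image_sub_ball (U : set X) (u : R) (x : X) : 0 < u ->
  diam U = u%:E -> U x -> F x ->
  f @` (U `&` F) `<=` ball (f x) (K * u `^ alpha).
Proof.
move=> u0 Uu Ux Fx _ [y [Uy Fy] <-]; rewrite ballEmdist/=.
apply: (le_lt_trans (f_holder _ _ Fx Fy)).
apply: (@le_lt_trans _ _ (C * u `^ alpha)).
  rewrite ler_wpM2l// ge0_ler_powR ?nnegrE ?mdist_ge0 ?(ltW u0)
    ?(ltW alpha0)//.
  by rewrite -lee_fin -Uu; exact: mdist_le_diam.
by rewrite ltr_pM2r ?powR_gt0// ltrDl invr_gt0.
Qed.

(** The first term pays for a single ball, the second for the balls of radius d / 2; its factor 2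
    comes from [covering_number_le]. *)
Let M := (2 * K) `^ t + 2 * CA * (2 * K) `^ a.

Lemma image_constant_gt0 : 0 < M.
Proof. by rewrite addr_gt0// ?mulr_gt0// powR_gt0// mulr_gt0. Qed.

Lemma image_piece_cover (U : set X) (u d lo : R) :
  (forall (y : Y) (r : R), 0 < r -> r <= d / 2 ->
     ball y r `\` ball y (c * r) !=set0) ->
  0 < d <= 1 -> 0 < u -> u <= d `^ (1 / (alpha * gamma)) ->
  lo <= u `^ alpha -> lo <= c * (d / 2) -> diam U = u%:E ->
  exists n (V : nat -> set Y),
    [/\ f @` (U `&` F) `<=` \bigcup_(j in `I_n) V j,
        forall j, (j < n)%N -> (lo%:E <= diam (V j) <= d%:E)%E
      & (\esum_(j in `I_n) (diam (V j) `^ t) <= M%:E * diam U `^ s)%E].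
Proof.
move=> up /andP[d0 d1] u0 ud lou lod Uu.
have u1 : u <= 1.
  apply: (le_trans ud); rewrite -[leRHS](powRr0 d) ger_powR ?d0// divr_ge0//.
  exact: ltW.
have [[x [Ux Fx]]|] := pselect (U `&` F !=set0); last first.
  (* A set missing [F] needs no ball at all. *)
  move=> /set0P/negP/negPn/eqP ->; exists 0%N, (fun=> set0).
  split => //; first by rewrite image_set0.
  by rewrite II0 esum_set0 mule_ge0 ?poweR_ge0 ?lee_fin
    ?(ltW image_constant_gt0).
rewrite Uu poweR_EFin -EFinM.
have fU := image_sub_ball U u x u0 Uu Ux Fx.
have ua0 : 0 < u `^ alpha by exact: powR_gt0.
have Kua0 : 0 < K * u `^ alpha by exact: mulr_gt0.
have diam_pow_le (V : set Y) (b : R) : 0 <= b -> (diam V <= b%:E)%E ->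
    (diam V `^ t <= (b `^ t)%:E)%E.
  move=> b0 Vb; rewrite -poweR_EFin gt0_ler_poweR ?image_exponent_ge0//.
    by rewrite in_itv/= leey andbT /diam le_max lexx.
  by rewrite in_itv/= leey andbT lee_fin.
have [small|large] := leP (2 * (K * u `^ alpha)) d.
  exists 1%N, (fun=> ball (f x) (K * u `^ alpha)); split.
  - by move=> y /fU ?; exists 0%N.
  - move=> _ _; apply/andP; split.
      apply: le_trans (diam_ball_ge _ _ _ Kua0 (up _ _ Kua0 _)); last lra.
      rewrite lee_fin (le_trans lou)// mulrA ler_peMl// ltW//.
    by apply: (le_trans (diam_ball_le _ _ (ltW Kua0))); rewrite lee_fin.
  apply: (le_trans (@esum_le_const _ _ _ ((2 * (K * u `^ alpha)) `^ t) _ _)).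
  - by move=> ?; exact: poweR_ge0.
  - move=> _ _; apply: diam_pow_le; last exact: diam_ball_le _ _ (ltW Kua0).
    by rewrite mulr_ge0// ltW.
  - rewrite mul1r lee_fin mulrA powRM ?(ltW ua0) ?mulr_ge0 ?(ltW K0)//.
    apply: ler_pM; rewrite ?powR_ge0//; last first.
      by apply: small_piece_cost; rewrite u0.
    by rewrite lerDl !mulr_ge0 ?powR_ge0 ?(ltW CA0).
(* The Assouad bound is used on the ball of doubled radius 2 K u^alpha, since [large] says exactly
   that this radius exceeds [d]. *)
have b0 : 0 < CA * (2 * (K * u `^ alpha) / d) `^ a.
  by rewrite mulr_gt0// powR_gt0// divr_gt0// mulr_gt0.
have fx : (f @` F) (f x) by exists x.
have [n [y [ny Ey]]] :=
  covering_number_le _ _ _ b0 (fF_assouad _ _ _ fx d0 large).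
pose V j := oapp (fun i => ball (y i) (d / 2)) set0 (insub j).
have VE (j : 'I_n) : V j = ball (y j) (d / 2).
  by rewrite /V valK.
have d20 : 0 < d / 2 by rewrite divr_gt0.
have Vd (j : 'I_n) : (lo%:E <= diam (V j) <= d%:E)%E.
  rewrite VE; apply/andP; split.
    apply: le_trans (diam_ball_ge _ _ _ d20 (up _ _ d20 (lexx _))).
    by rewrite lee_fin.
  apply: (le_trans (diam_ball_le _ _ (ltW d20))).
  by rewrite lee_fin mulrC divfK.
exists n, V; split.
- move=> z fz; have [|j _ yj] := Ey z.
    split; last by case: fz => w [_ Fw] <-; exists w.
    by apply: le_ball (fU _ fz); rewrite ler_peMl ?(ltW Kua0)// ler1n.
  by exists j; [exact: ltn_ord|rewrite VE].
- by move=> j jn; exact: (Vd (Ordinal jn)).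
- apply: (le_trans (@esum_le_const _ _ _ (d `^ t) _ _)).
  + by move=> ?; exact: poweR_ge0.
  + move=> j jn; apply: diam_pow_le; first exact: ltW.
    by have /andP[] := Vd (Ordinal jn).
  rewrite lee_fin; apply: (@le_trans _ _
      (2 * CA * (2 * K) `^ a * ((u `^ alpha / d) `^ a * d `^ t))).
    rewrite mulrA ler_wpM2r ?powR_ge0//; apply: (le_trans ny).
    rewrite [2 * (K * _)]mulrA -[2 * K * _ / d]mulrA powRM ?mulrA//.
      by rewrite mulr_ge0// ltW.
    by rewrite divr_ge0// ltW.
  apply: ler_pM; rewrite ?mulr_ge0 ?powR_ge0 ?(ltW CA0)//; last first.
    exact: large_piece_cost.
  by rewrite lerDr powR_ge0.
Qed.

End HolderImage.

(** * Images of whole covers at small scales *)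

Lemma at_right0_witness {R : realType} (P : R -> Prop) :
  (\forall d \near (0 : R)^'+, P d) ->
  exists2 e : R, 0 < e & forall d, 0 < d < e -> P d.
Proof.
rewrite near_withinE => /nbhs_ballP[e/= e0 Pe]; exists e => // d /andP[d0 de].
by apply: Pe => //; rewrite /ball/= sub0r normrN gtr0_norm.
Qed.

(** Since [M] and [e] depend on neither [d] nor [eps], this single-scale statement serves both the
    upper and the lower dimension. *)
Lemma has_cover_image {R : realType} (Delta Delta1 : R) (Phi Phi1 : R -> R)
    (X Y : metricType R) (F : set X) (f : X -> Y) (alpha gamma s a : R) :
  admissible Delta Phi -> admissible Delta1 Phi1 ->
  uniformly_perfect Y -> (exists y y' : Y, y <> y') ->
  0 < alpha -> holder_on F alpha f -> 1 <= gamma ->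
  (\forall d \near 0^'+, Phi1 d <= Phi (d `^ (1 / (alpha * gamma))) `^ alpha) ->
  (exists2 CA : R, 0 < CA & forall (x : Y) (r r' : R),
    (f @` F) x -> 0 < r -> r < r' ->
    (covering_number r (ball x r' `&` f @` F) <= (CA * (r' / r) `^ a)%:E)%E) ->
  0 <= s -> s <= alpha * a ->
  exists M e : R, [/\ 0 < M, 0 < e <= 1, e <= Delta1 &
    forall d eps : R, 0 < d < e -> d `^ (1 / (alpha * gamma)) < Delta ->
      has_cover F (Phi (d `^ (1 / (alpha * gamma))))
        (d `^ (1 / (alpha * gamma))) s eps ->
      has_cover (f @` F) (Phi1 d) d
        ((s + alpha * (gamma - 1) * a) / (alpha * gamma)) (M * eps)].
Proof.
move=> [Delta0 _ Phi_bnd _] [Delta10 _ _ Phi1_lim].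
move=> [c /andP[c0 c1] up] Y_nontriv alpha0 [C C0 fC] gamma1.
move=> Phi1_le [CA CA0 fF] s0 sa.
(* A finite radius below the possibly infinite diameter of [Y]: uniform perfectness applies up to
   it. *)
have [r0 r00 r0Y] : exists2 r0 : R, 0 < r0 & (r0%:E < diam [set: Y])%E.
  have := diam_setT_gt0 Y_nontriv; case: (diam _) => [r| |]//.
    by rewrite lte_fin => r0; exists (r / 2); rewrite ?lte_fin; lra.
  by move=> _; exists 1 => //; exact: ltry.
have : \forall d \near (0 : R)^'+,
    Phi1 d <= Phi (d `^ (1 / (alpha * gamma))) `^ alpha /\
    Phi1 d <= c * (d / 2).
  near=> d; split; first by near: d.
  have d0 : 0 < d by near: d; exact: nbhs_right_gt.
  have -> : c * (d / 2) = c / 2 * d by lra.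
  by rewrite -ler_pdivrMr//; near: d; apply: (cvgr_le _ Phi1_lim); lra.
move=> /at_right0_witness[e1 e10 e1P].
pose e := Num.min (Num.min e1 r0) (Num.min 1 Delta1).
have e0 : 0 < e by rewrite !lt_min e10 r00 Delta10 ltr01.
exists ((2 * (C + c^-1)) `^ ((s + alpha * (gamma - 1) * a) / (alpha * gamma))
  + 2 * CA * (2 * (C + c^-1)) `^ a), e; split.
- exact: image_constant_gt0.
- by rewrite e0 !ge_min lexx !orbT.
- by rewrite !ge_min lexx !orbT.
move=> d eps /andP[d0]; rewrite !lt_min => /andP[/andP[de1 dr0] /andP[d1 _]].
move=> dDelta; have [|Phi1_lo Phi1_lo'] := e1P d; first by rewrite d0.
have d'0 : 0 < d `^ (1 / (alpha * gamma)) by exact: powR_gt0.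
have /Phi_bnd/andP[Phi0 _] : 0 < d `^ (1 / (alpha * gamma)) < Delta.
  by rewrite d'0.
apply: has_cover_glue; first by apply/ltW/image_constant_gt0.
move=> U; case Uu : (diam U) => [u| |]//; rewrite ?lee_fin => /andP[lou uhi].
rewrite -Uu.
have u0 : 0 < u by exact: lt_le_trans lou.
apply: (image_piece_cover alpha gamma s a alpha0 gamma1 s0 sa F f C c CA
  C0 c0 CA0 fC fF U u d (Phi1 d)) => //.
- move=> y r rpos rd; apply: up => //; apply: lt_trans r0Y.
  by rewrite lte_fin; lra.
- by rewrite d0 ltW.
(* With d' = d^(1/(alpha gamma)), this is Phi1(d) <= Phi(d')^alpha <= u^alpha. *)
- apply: (le_trans Phi1_lo).
  by apply: ge0_ler_powR; rewrite ?nnegrE ?(ltW alpha0) ?(ltW Phi0) ?(ltW u0).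
Unshelve. all: by end_near. Qed.

(** * Upper and lower dimensions of the image *)

Theorem theorem4p1 (R : realType) (Delta Delta1 : R) (Phi Phi1 : R -> R)
    (X Y : metricType R) (F : set X) (f : X -> Y) (alpha gamma : R)
    (Phi_adm : admissible Delta Phi) (Phi1_adm : admissible Delta1 Phi1)
    (X_up : uniformly_perfect X) (Y_up : uniformly_perfect Y)
    (X_nontriv : exists x x' : X, x <> x')
    (Y_nontriv : exists y y' : Y, y <> y')
    (F_neq0 : F !=set0) (F_tb : totally_bounded F)
    (alpha_bounds : 0 < alpha <= 1) (f_holder : holder_on F alpha f)
    (dimA_fin : (assouad_dim (f @` F) < +oo)%E)
    (gamma_bounds : 1 <= gamma <= 1 / alpha)
    (Phi1_le : \forall d \near 0^'+,
       Phi1 d <= (Phi (d `^ (1 / (alpha * gamma)))) `^ alpha) :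
  ((upper_Phi_dim Delta Phi F < alpha%:E * assouad_dim (f @` F))%E ->
   (upper_Phi_dim Delta1 Phi1 (f @` F) <=
      (upper_Phi_dim Delta Phi F
         + (alpha * (gamma - 1))%:E * assouad_dim (f @` F))
      / (alpha * gamma)%:E)%E) /\
  ((lower_Phi_dim Delta Phi F < alpha%:E * assouad_dim (f @` F))%E ->
   (lower_Phi_dim Delta1 Phi1 (f @` F) <=
      (lower_Phi_dim Delta Phi F
         + (alpha * (gamma - 1))%:E * assouad_dim (f @` F))
      / (alpha * gamma)%:E)%E).
Proof.
have /andP[alpha0 _] := alpha_bounds; have /andP[gamma1 _] := gamma_bounds.
have gamma0 : 0 < gamma by exact: lt_le_trans gamma1.
have ag0 : 0 < alpha * gamma by exact: mulr_gt0.
have m0 : 0 <= alpha * (gamma - 1) by rewrite mulr_ge0 ?subr_ge0// ltW.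
have powK (x : R) : 0 <= x ->
    (x `^ (alpha * gamma)) `^ (1 / (alpha * gamma)) = x.
  by move=> x0; rewrite -powRrM mulrC divfK ?gt_eqF// powRr1.
have powVK (x : R) : 0 <= x ->
    (x `^ (1 / (alpha * gamma))) `^ (alpha * gamma) = x.
  by move=> x0; rewrite powRAC powK.
have image s a := @has_cover_image R Delta Delta1 Phi Phi1 X Y F f alpha gamma
  s a Phi_adm Phi1_adm Y_up Y_nontriv alpha0 f_holder gamma1 Phi1_le.
split=> dim_lt;
  apply: (ereal_inf_transfer _ _ _ _ _ _ alpha0 ag0 m0 _ dimA_fin dim_lt).
- by move=> s [].
- move=> s a [s0 sP] aA sa; split; first exact: image_exponent_ge0.
  have [M [e [M0 /andP[e0 e1] eDelta1 imageP]]] := image s a aA s0 sa.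
  move=> eps eps0; have [|d0 [/andP[d00 _] d0Delta coverP]] := sP (eps / M).
    exact: divr_gt0.
  have d0ag0 : 0 < d0 `^ (alpha * gamma) by exact: powR_gt0.
  (* Below this threshold, d^(1/(alpha gamma)) < d0, so [F] has a cover at that scale. *)
  exists (Num.min e (d0 `^ (alpha * gamma))); split.
  + by rewrite lt_min e0 d0ag0/= ge_min e1.
  + by rewrite ge_min eDelta1.
  + move=> d /andP[dpos]; rewrite lt_min => /andP[de dd0].
    have d'd0 : d `^ (1 / (alpha * gamma)) < d0.
      rewrite -[ltRHS]powK ?(ltW d00)//.
      apply: gt0_ltr_powR; rewrite ?divr_gt0 ?nnegrE ?(ltW dpos)//.
      exact: ltW.
    have -> : eps = M * (eps / M) by rewrite mulrC divfK ?gt_eqF.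
    apply: imageP; rewrite ?dpos//; first exact: lt_le_trans d0Delta.
    by apply: coverP; rewrite d'd0 powR_gt0.
- by move=> s [].
- move=> s a [s0 sP] aA sa; split; first exact: image_exponent_ge0.
  have [M [e [M0 /andP[e0 e1] eDelta1 imageP]]] := image s a aA s0 sa.
  move=> eps d0 eps0 /andP[d00 d01].
  (* For the lower dimension the good scale [d] is chosen for [F], below r^(1/(alpha gamma)); the
     image then uses d^(alpha gamma) < r. *)
  pose r := Num.min e d0; have rpos : 0 < r by rewrite lt_min e0.
  have r'0 : 0 < r `^ (1 / (alpha * gamma)) by exact: powR_gt0.
  have r'1 : r `^ (1 / (alpha * gamma)) <= 1.
    rewrite -[leRHS](powRr0 r) ger_powR ?rpos ?ge_min ?e1//.
    by rewrite divr_ge0// ltW.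
  have [||d [/andP[dpos dr'] dDelta dcover]] :=
      sP (eps / M) (r `^ (1 / (alpha * gamma))).
  + exact: divr_gt0.
  + by rewrite r'0.
  have dagr : d `^ (alpha * gamma) < r.
    rewrite -[ltRHS]powVK ?(ltW rpos)//.
    by apply: gt0_ltr_powR; rewrite ?nnegrE ?(ltW dpos) ?(ltW r'0).
  have dag0 : 0 < d `^ (alpha * gamma) by exact: powR_gt0.
  move: dagr; rewrite lt_min => /andP[dage dagd0].
  exists (d `^ (alpha * gamma)); split.
  + by rewrite dag0.
  + exact: lt_le_trans eDelta1.
  have -> : eps = M * (eps / M) by rewrite mulrC divfK ?gt_eqF.
  by apply: imageP; rewrite ?powK ?(ltW dpos)// dag0.
Qed.
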